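(* Let $\mathbb{F}_q$ be a finite field of characteristic different from $2$ and $3$, let $E: y^2=x^3+Ax+B$ with $A,B\in\mathbb{F}_q$ be an elliptic curve, let $n$ be an odd prime, and let $T_n$ be the trace zero subgroup of $E(\mathbb{F}_{q^n})$. Let $f_n$ be the $n$-th summation polynomial of $E$, let $g_n$ be the symmetrized $n$-th summation polynomial, and let $d_n$ be the degree of $g_n(s_1,\ldots,s_n)$ in the last indeterminate $s_n$. For an affine point $P=(X,Y)\in T_n$ put $$\mathrm{compr}(P)=(S_1,\ldots,S_{n-1})\in\mathbb{F}_q^{\,n-1},\qquad S_i=e_i(X,X^q,\ldots,X^{q^{n-1}}).$$ Let $P\in T_n$ be an affine point with $\mathrm{compr}(P)=(S_1,\ldots,S_{n-1})$ such that $g_n(S_1,\ldots,S_{n-1},t)$ is not the zero polynomial in $t$. Then the set of affine points $Q\in T_n$ with $\mathrm{compr}(Q)=\mathrm{compr}(P)$ is a union of at most $d_n$ equivalence classes, where the equivalence class of an affine point $Q\in T_n$ is $\{\pm\varphi^i(Q)\mid 0\le i\le n-1\}$.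
   Context: $\mathcal{O}$ denotes the point at infinity, the neutral element of $E$; affine points are points different from $\mathcal{O}$. The Frobenius endomorphism is $\varphi:E\to E$, $(X,Y)\mapsto(X^q,Y^q)$, $\mathcal{O}\mapsto\mathcal{O}$. The trace map is $\mathrm{Tr}:E(\mathbb{F}_{q^n})\to E(\mathbb{F}_q)$, $P\mapsto P+\varphi(P)+\cdots+\varphi^{n-1}(P)$, and $T_n=\ker(\mathrm{Tr})\subseteq E(\mathbb{F}_{q^n})$. Semaev's summation polynomials $f_m\in\mathbb{F}_q[z_1,\ldots,z_m]$, $m\ge 3$, of $E$ are defined recursively by $$f_3(z_1,z_2,z_3)=(z_1-z_2)^2z_3^2-2\bigl((z_1+z_2)(z_1z_2+A)+2B\bigr)z_3+(z_1z_2-A)^2-4B(z_1+z_2),$$ $$f_m(z_1,\ldots,z_m)=\mathrm{Res}_z\bigl(f_{m-k}(z_1,\ldots,z_{m-k-1},z),\,f_{k+2}(z_{m-k},\ldots,z_m,z)\bigr)$$ for $m\ge4$ and $m-3\ge k\ge1$. A known theorem of Semaev, which may be used: for $m\geq 3$ and $Z_1,\ldots,Z_m\in\overline{\mathbb{F}}_q$, one has $f_m(Z_1,\ldots,Z_m)=0$ if and only if there exist $Y_1,\ldots,Y_m\in\overline{\mathbb{F}}_q$ such that the points $(Z_i,Y_i)$ lie on $E$ and $(Z_1,Y_1)+\cdots+(Z_m,Y_m)=\mathcal{O}$. Moreover $f_m$ is symmetric. Let $e_i(z_1,\ldots,z_n)=\sum_{1\le j_1<\cdots<j_i\le n}z_{j_1}\cdots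 z_{j_i}$ be the elementary symmetric polynomials. Since $f_n$ is symmetric, there is a unique polynomial $g_n\in\mathbb{F}_q[s_1,\ldots,s_n]$ with $f_n(z_1,\ldots,z_n)=g_n(e_1(z_1,\ldots,z_n),\ldots,e_n(z_1,\ldots,z_n))$; it is called the symmetrized $n$-th summation polynomial. For $X\in\mathbb{F}_{q^n}$ one has $e_i(X,X^q,\ldots,X^{q^{n-1}})\in\mathbb{F}_q$. *)

(* Defs.v *)
From HB Require Import structures.
From mathcomp Require Import all_boot all_order all_algebra all_fingroup all_solvable all_field.
From mathcomp.multinomials Require Import mpoly.

Set Implicit Arguments.
Unset Strict Implicit.
Unset Printing Implicit Defensive.

Import GRing.Theory.
Local Open Scope ring_scope.

(* The field F plays the role of F_q, with q = #|F|, and the field L that of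
   F_{q^n}, embedded by iota : F -> L.
   Affine points are pairs of coordinates; None is the point at infinity. *)
Notation point K := (option (K * K)).

Definition elliptic (K : fieldType) (a b : K) : bool :=
  4%:R * a ^+ 3 + 27%:R * b ^+ 2 != 0.

Definition on_curve (K : fieldType) (a b : K) (P : point K) : bool :=
  if P is Some (x, y) then y ^+ 2 == x ^+ 3 + a * x + b else true.

Definition aff_opp (K : fieldType) (P : K * K) : K * K := (P.1, - P.2).

(* Chord-and-tangent addition on y^2 = x^3 + a x + b; the constant b is not
   needed in the formulas. *)
Definition ec_add (K : fieldType) (a : K) (P Q : point K) : point K :=
  match P, Q with
  | None, _ => Q
  | _, None => P
  | Some (x1, y1), Some (x2, y2) =>
    if (x1 == x2) && (y1 == - y2) then None else
    let s := if x1 == x2 then (3%:R * x1 ^+ 2 + a) / (2%:R * y1)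
             else (y2 - y1) / (x2 - x1) in
    let x3 := s ^+ 2 - x1 - x2 in
    Some (x3, s * (x1 - x3) - y1)
  end.

Definition aff_frob (K : fieldType) (q : nat) (P : K * K) : K * K :=
  (P.1 ^+ q, P.2 ^+ q).

Definition frob (K : fieldType) (q : nat) (P : point K) : point K :=
  omap (aff_frob q) P.

(* P + (phi(P) + (... + phi^{n-1}(P))): ec_add is not registered as a monoid law,
   but on a curve the bracketing is irrelevant. *)
Definition ec_trace (K : fieldType) (a : K) (q n : nat) (P : point K) : point K :=
  \big[@ec_add K a/None]_(i < n) iter i (frob q) P.

Definition trace_zero (K : finFieldType) (a b : K) (q n : nat) :
    {set point K} :=
  [set P | on_curve a b P && (ec_trace a q n P == None)].

Definition aff_trace_zero (K : finFieldType) (a b : K) (q n : nat) :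
    {set K * K} :=
  [set P | Some P \in trace_zero a b q n].

(* {+- phi^i(Q) | 0 <= i <= n-1} *)
Definition eq_class (K : finFieldType) (q n : nat) (Q : K * K) :
    {set K * K} :=
  [set iter i (aff_frob q) Q | i : 'I_n]
    :|: [set aff_opp (iter i (aff_frob q) Q) | i : 'I_n].

Definition semaev3 (R : comNzRingType) (a b z1 z2 z3 : R) : R :=
  (z1 - z2) ^+ 2 * z3 ^+ 2
  - 2%:R * ((z1 + z2) * (z1 * z2 + a) + 2%:R * b) * z3
  + ((z1 * z2 - a) ^+ 2 - 4%:R * b * (z1 + z2)).

(* With the variables z_1, ..., z_{m+1} numbered from 0, this is
     Res_z (p(z_1, ..., z_{m-1}, z), f_3(z_m, z_{m+1}, z)),
   a resultant of univariate polynomials over {mpoly F[m.+1]}. *)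
Definition semaev_step (F : fieldType) (a b : F) (m : nat)
    (p : {mpoly F[m]}) : {mpoly F[m.+1]} :=
  let c (u : {mpoly F[m.+1]}) : {poly {mpoly F[m.+1]}} := u%:P in
  resultant
    (mmap (fun u : F => c u%:MP)
          (fun i : 'I_m => if (i.+1 < m)%N then c 'X_(inord i) else 'X) p)
    (semaev3 (c a%:MP) (c b%:MP) (c 'X_(inord m.-1)) (c 'X_(inord m)) 'X).

(* Semaev's recursion f_m = Res_z (f_{m-k}, f_{k+2}) with k = 1 at every step;
   all admissible k yield the same polynomial.  Here m = k.+3. *)
Fixpoint summation_poly_rec (F : fieldType) (a b : F) (k : nat) :
    {mpoly F[k.+3]} :=
  if k is k'.+1 then semaev_step a b (summation_poly_rec a b k')
  else semaev3 a%:MP b%:MP 'X_(inord 0) 'X_(inord 1) 'X_(inord 2).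

(* f_m is only meaningful for m >= 3. *)
Definition summation_poly (F : fieldType) (a b : F) (m : nat) : {mpoly F[m]} :=
  if m is k.+3 then summation_poly_rec a b k else 0.

(* g is the polynomial with p(z_1, ..., z_n) = g(e_1(z), ..., e_n(z)); it is
   unique, by msym_fundamental_un. *)
Definition is_symmetrization (F : fieldType) (n : nat)
    (p g : {mpoly F[n]}) : Prop :=
  p = g \mPo [tuple mesym n F i.+1 | i < n].

(* The degree of g in its last variable, which has index n.-1. *)
Definition last_degree (F : fieldType) (n : nat) (g : {mpoly F[n]}) : nat :=
  (\max_(m <- msupp g) nth 0 m n.-1)%N.

(* g(S_1, ..., S_{n-1}, t) as a polynomial in t *)
Definition specialize_last (F : fieldType) (n : nat) (g : {mpoly F[n]})
    (S : n.-1.-tuple F) : {poly F} :=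
  mmap (@polyC F) (fun i : 'I_n => if (i < n.-1)%N then (S`_i)%:P else 'X) g.

(* e_i(X, X^q, ..., X^{q^(n-1)}), as an element of L *)
Definition esym_conj (L : fieldType) (q n i : nat) (x : L) : L :=
  (mesym n L i).@[fun j : 'I_n => x ^+ (q ^ j)].

(* The preimage of y under the embedding iota (0 if there is none). *)
Definition descend (F L : finFieldType) (iota : F -> L) (y : L) : F :=
  odflt 0 [pick s : F | iota s == y].

(* The default of descend is never reached, see comprE. *)
Definition compr (F L : finFieldType) (iota : F -> L) (n : nat) (P : L * L) :
    n.-1.-tuple F :=
  [tuple descend iota (esym_conj #|F| n i.+1 P.1) | i < n.-1].

Lemma descendK (F L : finFieldType) (iota : {rmorphism F -> L}) (y : L) :
  y ^+ #|F| = y -> iota (descend iota y) = y.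
Proof.
move=> yq; rewrite /descend; case: pickP => [s /eqP //|no_s].
have /(congr1 (fun p => (map_poly iota p).[y])) := finField_genPoly F.
rewrite rmorphB /= map_polyXn map_polyX !hornerE yq subrr rmorph_prod.
rewrite horner_prod => /esym/eqP/prodf_eq0[s _].
rewrite rmorphB /= map_polyX map_polyC !hornerE subr_eq0 eq_sym => ys.
by have := no_s s; rewrite ys.
Qed.

Lemma esym_conj_frob (F L : finFieldType) (iota : {rmorphism F -> L})
    (n i : nat) (x : L) :
  #|L| = (#|F| ^ n)%N ->
  esym_conj #|F| n i x ^+ #|F| = esym_conj #|F| n i x.
Proof.
move=> cardL; rewrite /esym_conj; set q := #|F|.
have natq : [pchar L].-nat q.
  have [p _ pF] := finPcharP F.
  have := abelem_pgroup (fin_ring_pchar_abelem pF).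
  rewrite /pgroup cardsT; apply: sub_in_pnat => r _; rewrite !inE => /eqP->.
  exact: (rmorph_pchar iota pF).
have addq (y z : L) : (y + z) ^+ q = y ^+ q + z ^+ q by exact: exprDn_pchar.
have zeroq : 0 ^+ q = 0 :> L.
  by rewrite expr0n -leqn0 leqNgt (ltnW (card_finNzRing_gt1 F)).
have evalE : (mesym n L i).@[fun j : 'I_n => x ^+ (q ^ j)]
    = \sum_(h : {set 'I_n} | #|h| == i) \prod_(j in h) x ^+ (q ^ j).
  rewrite /mesym raddf_sum /=; apply: eq_bigr => h _.
  by rewrite rmorph_prod /=; apply: eq_bigr => j _; rewrite mevalXU.
have stepE (j : 'I_n) : (x ^+ (q ^ j)) ^+ q = x ^+ (q ^ ordS j).
  rewrite -exprM -expnSr /=.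
  have [jn | jn] := ltnP j.+1 n; first by rewrite modn_small.
  have -> : j.+1 = n by apply/eqP; rewrite eqn_leq jn ltn_ord.
  by rewrite modnn expn0 expr1 -cardL expf_card.
rewrite evalE (big_morph (fun y : L => y ^+ q) addq zeroq).
rewrite [RHS](reindex (fun h : {set 'I_n} => @ordS n @: h)) /=; last first.
  exists (fun h : {set 'I_n} => @ord_pred n @: h) => h _; rewrite -imset_comp.
    by rewrite (eq_imset _ (@ordSK n)) imset_id.
  by rewrite (eq_imset _ (@ord_predK n)) imset_id.
apply: eq_big => [h | h _]; first by rewrite card_imset //; exact: ordS_inj.
rewrite -prodrXl big_imset /=; last by move=> ? ? _ _; exact: ordS_inj.
by apply: eq_bigr => j _; rewrite stepE.
Qed.

Lemma comprE (F L : finFieldType) (iota : {rmorphism F -> L}) (n : nat)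
    (P : L * L) (i : 'I_n.-1) :
  #|L| = (#|F| ^ n)%N ->
  iota (tnth (compr iota n P) i) = esym_conj #|F| n i.+1 P.1.
Proof.
by move=> cardL; rewrite tnth_mktuple descendK // (esym_conj_frob iota).
Qed.

(* Main.v *)
Require Import Defs.
From mathcomp Require Import all_boot all_order all_algebra all_fingroup all_solvable all_field.
From mathcomp.multinomials Require Import mpoly.
From mathcomp Require Import ring zify.

Set Implicit Arguments.
Unset Strict Implicit.
Unset Printing Implicit Defensive.

Import GRing.Theory.
Local Open Scope ring_scope.

(* For Q in T_n with compr(Q) = compr(P), the vanishing of the trace gives
   f_n(X, X^q, ..., X^{q^{n-1}}) = 0, so the norm e_n(X, ..., X^{q^{n-1}}) of
   the abscissa X of Q is a root of g_n(S_1, ..., S_{n-1}, t).  There are at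
   most d_n such roots, and all e_i together determine the conjugates of X,
   hence Q up to sign and Frobenius.

   Only one direction of Semaev's theorem is needed: a sum of affine points
   equal to O makes f_m vanish.  With right-nested sums the recursion
   f_{m+1} = Res_z(f_m(z_1, ..., z_{m-1}, z), f_3(z_m, z_{m+1}, z)) replaces the
   last two points by their sum R, so associativity of the group law is never
   used.  If R is affine, its abscissa is a common root of the two polynomials.
   If R = O, both leading coefficients in z have to vanish after evaluation.
   For f_m this holds because its leading coefficient in the last variable is
   Res_z(f_{m-1}(z_1, ..., z_{m-2}, z), (z - z_{m-1})^2), which shares the root
   z_{m-1} as soon as f_{m-1}(z_1, ..., z_{m-1}) = 0; for m = 3 the leading
   coefficient is (z_1 - z_2)^2.  The same formula shows
   that the degree of f_m in its last variable is exactly 2^{m-2}; this exact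
   generic degree is the size of the Sylvester matrix that is specialized. *)

(** * Sylvester determinants of prescribed size *)

(* Unlike in [resultant], the nominal degrees d and e are fixed independently of
   the coefficient sequences p and q, so that the matrix commutes with
   specialization even when leading coefficients vanish. *)
Definition sylvester (R : pzRingType) (d e : nat) (p q : nat -> R) : 'M[R]_(e + d) :=
  \matrix_(i, j) if (i < e)%N then p (j - i)%N *+ (i <= j)%N
                 else q (j - (i - e))%N *+ (i - e <= j)%N.

Lemma det_sylvester_map (R S : comNzRingType) (f : {rmorphism R -> S}) d e
    (p q : nat -> R) :
  f (\det (sylvester d e p q)) = \det (sylvester d e (f \o p) (f \o q)).
Proof.
rewrite -det_map_mx; congr (\det _); apply/matrixP => i j; rewrite !mxE.
by case: ifP => _; rewrite rmorphMn.
Qed.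

Lemma eq_sylvester (R : pzRingType) d e (p p' q q' : nat -> R) :
  p =1 p' -> q =1 q' -> sylvester d e p q = sylvester d e p' q'.
Proof.
by move=> pE qE; apply/matrixP => i j; rewrite !mxE pE qE.
Qed.

Lemma resultant_sylvester (R : comNzRingType) (p q : {poly R}) :
  resultant p q =
  \det (sylvester (size p).-1 (size q).-1 (fun i => p`_i) (fun i => q`_i)).
Proof.
congr (\det _); apply/matrixP => i j; rewrite Sylvester_mxE mxE.
by case: splitP => k ->; rewrite ?addKn.
Qed.

(** Multiplying by the adjugate gives that [\det M] times [v] is zero, so over any commutative ring
    one entry of [v] equal to 1 suffices. *)
Lemma det_eq0_of_ker (R : comNzRingType) n (M : 'M[R]_n) (v : 'cV_n) i :
  M *m v = 0 -> v i 0 = 1 -> \det M = 0.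
Proof.
move=> Mv0 vi; have: (\adj M *m M *m v) i 0 = 0 by rewrite -mulmxA Mv0 mulmx0 mxE.
by rewrite mul_adj_mx mul_scalar_mx mxE vi mulr1.
Qed.

Lemma sum_shifted_coef (R : comNzRingType) (p : {poly R}) (z : R) (N k : nat) :
  (k + size p <= N)%N ->
  \sum_(j < N) (p`_(j - k) *+ (k <= j)%N) * z ^+ j = z ^+ k * p.[z].
Proof.
move=> szp.
have -> : z ^+ k * p.[z] = ('X^k * p).[z] by rewrite hornerM hornerXn.
rewrite (@horner_coef_wide _ N); last first.
  apply: leq_trans (size_polyMleq _ _) _; rewrite size_polyXn; lia.
by apply: eq_bigr => j _; rewrite coefXnM ltnNge; case: leqP.
Qed.

(** The powers of [z] form a kernel vector, since each row yields a power of [z] times [p.[z]] or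
    [q.[z]]; its entry of index 0 is 1. *)
Lemma sylvester_common_root (R : comNzRingType) d e (p q : {poly R}) z :
  (0 < d)%N -> (size p <= d.+1)%N -> (size q <= e.+1)%N ->
  p.[z] = 0 -> q.[z] = 0 ->
  \det (sylvester d e (fun i => p`_i) (fun i => q`_i)) = 0.
Proof.
move=> d0 szp szq pz qz.
have N0 : (0 < e + d)%N by lia.
apply: (@det_eq0_of_ker _ _ _ (\col_j z ^+ j) (Ordinal N0)); last by rewrite mxE.
apply/matrixP => i k; rewrite !mxE.
under eq_bigr => j _ do rewrite !mxE.
have := ltn_ord i; case: (ltnP i e) => ie iN.
  by rewrite (@sum_shifted_coef _ p) ?pz ?mulr0 //; lia.
by rewrite (@sum_shifted_coef _ q) ?qz ?mulr0 //; lia.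
Qed.

(** The last column is zero: it meets [p] only in degrees at least [d] and [q] only in degrees at
    least [e]. *)
Lemma sylvester_lead0 (R : comNzRingType) d e (p q : {poly R}) :
  (0 < d)%N -> (size p <= d.+1)%N -> (size q <= e.+1)%N ->
  p`_d = 0 -> q`_e = 0 ->
  \det (sylvester d e (fun i => p`_i) (fun i => q`_i)) = 0.
Proof.
move=> d0 szp szq pz qz.
have N0 : ((e + d).-1 < e + d)%N by lia.
apply: (@det_eq0_of_ker _ _ _ (delta_mx (Ordinal N0) 0) (Ordinal N0)); last first.
  by rewrite mxE !eqxx.
rewrite -colE; apply/matrixP => i k; rewrite !mxE /=.
have co (r : {poly R}) m l : (size r <= m.+1)%N -> r`_m = 0 -> (m <= l)%N -> r`_l = 0.
  move=> szr rm; rewrite leq_eqVlt => /predU1P[<- //|ml].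
  exact/nth_default/(leq_trans szr).
have := ltn_ord i; case: (ltnP i e) => ie iN.
  by rewrite (co p d) ?mul0rn //; lia.
by rewrite (co q e) ?mul0rn //; lia.
Qed.

Lemma coef_prod_top (R : comNzRingType) (I : Type) (r : seq I)
    (P : I -> {poly R}) (D : I -> nat) :
  (forall i, (size (P i) <= (D i).+1)%N) ->
  (size (\prod_(i <- r) P i)%R <= (\sum_(i <- r) D i).+1)%N
  /\ (\prod_(i <- r) P i)`_(\sum_(i <- r) D i) = \prod_(i <- r) (P i)`_(D i).
Proof.
move=> szP; elim: r => [|i r [IHs IHc]].
  by rewrite !big_nil size_poly1 coef1.
rewrite !big_cons; split.
  apply: leq_trans (size_polyMleq _ _) _.
  by have := szP i; move: IHs; lia.
rewrite coefM (bigD1 (inord (D i))) //= inordK; last lia.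
rewrite addKn IHc [X in _ + X]big1 ?addr0 // => j ji.
have {}ji : (j != D i :> nat).
  by apply: contra ji => /eqP jD; apply/eqP/val_inj; rewrite /= inordK; lia.
have [jD|jD] := ltnP j (D i).
  rewrite [X in _ * X]nth_default ?mulr0 //.
  by apply: leq_trans IHs _; lia.
rewrite nth_default ?mul0r //; apply: leq_trans (szP i) _; lia.
Qed.

(** Each product in the Leibniz expansion takes one entry per row, so row-wise degree bounds add up
    and top coefficients multiply. *)
Lemma coef_det_top (R : comNzRingType) n (M : 'M[{poly R}]_n) (D : 'I_n -> nat) :
  (forall i j, (size (M i j) <= (D i).+1)%N) ->
  (size (\det M) <= (\sum_i D i).+1)%N
  /\ (\det M)`_(\sum_i D i) = \det (\matrix_(i, j) (M i j)`_(D i)).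
Proof.
move=> szM; rewrite /determinant.
have top (s : {perm 'I_n}) := coef_prod_top (index_enum 'I_n) (fun i => szM i (s i)).
split.
  apply: (leq_trans (size_sum _ _ _)); apply/bigmax_leqP => s _.
  by case: (odd_perm s); rewrite ?mulN1r ?size_polyN ?mul1r; case: (top s).
rewrite coef_sum; apply: eq_bigr => s _.
under [in RHS]eq_bigr => i _ do rewrite mxE.
case: (top s) => _ <-.
by case: (odd_perm s); rewrite ?mulN1r ?coefN ?mul1r.
Qed.

(** * Specializations of the summation polynomials *)

Definition semaev3_coef (R : comNzRingType) (a b x y : R) (i : nat) : R :=
  [:: (x * y - a) ^+ 2 - 4%:R * b * (x + y);
      - (2%:R * ((x + y) * (x * y + a) + 2%:R * b)); (x - y) ^+ 2]`_i.

Lemma semaev3_Poly (R : comNzRingType) (a b x y : R) :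
  semaev3 a%:P b%:P x%:P y%:P 'X = Poly (mkseq (semaev3_coef a b x y) 3).
Proof.
rewrite /mkseq /= !cons_poly_def mul0r add0r /semaev3 /semaev3_coef /=.
ring.
Qed.

Lemma coef_semaev3 (R : comNzRingType) (a b x y : R) i :
  (semaev3 a%:P b%:P x%:P y%:P 'X)`_i = semaev3_coef a b x y i.
Proof.
rewrite semaev3_Poly coef_Poly; case: (ltnP i 3) => i3; first by rewrite nth_mkseq.
by rewrite nth_default ?size_mkseq // /semaev3_coef nth_default.
Qed.

Lemma size_semaev3_le (R : comNzRingType) (a b x y : R) :
  (size (semaev3 a%:P b%:P x%:P y%:P 'X) <= 3)%N.
Proof. by rewrite semaev3_Poly; apply: leq_trans (size_Poly _) _. Qed.

Lemma size_semaev3 (R : idomainType) (a b x y : R) :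
  x != y -> size (semaev3 a%:P b%:P x%:P y%:P 'X) = 3%N.
Proof.
by move=> xy; rewrite semaev3_Poly (PolyK (c := 0)) //= expf_neq0 // subr_eq0.
Qed.

Lemma rmorph_semaev3 (R S : comNzRingType) (f : {rmorphism R -> S}) a b x y z :
  f (semaev3 a b x y z) = semaev3 (f a) (f b) (f x) (f y) (f z).
Proof.
by rewrite /semaev3; ring.
Qed.

Lemma horner_semaev3 (R : comNzRingType) (a b x y z : R) :
  (semaev3 a%:P b%:P x%:P y%:P 'X).[z] = semaev3 a b x y z.
Proof. by rewrite -horner_evalE rmorph_semaev3 /= !horner_evalE !hornerE. Qed.

Lemma rmorph_semaev3_coef (R S : comNzRingType) (f : {rmorphism R -> S}) a b x y i :
  f (semaev3_coef a b x y i) = semaev3_coef (f a) (f b) (f x) (f y) i.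
Proof.
case: i => [|[|[|i]]] /=; rewrite /semaev3_coef /= ?nth_nil ?rmorph0 //;
ring.
Qed.

(* As z_2 goes to infinity, f_3(x, z_2, z) / z_2^2 tends to (z - x)^2. *)
Lemma semaev3_coefX (R : comNzRingType) (a b x : R) i :
  let c := semaev3_coef a%:P b%:P x%:P 'X i in
  (size c <= 3)%N /\ c`_2 = (('X - x%:P) ^+ 2)`_i.
Proof.
have sqE : ('X - x%:P) ^+ 2 = Poly [:: x ^+ 2; - (2%:R * x); 1].
  rewrite /= !cons_poly_def mul0r add0r.
  ring.
have szP (c : {poly R}) (c0 c1 c2 : R) : c = Poly [:: c0; c1; c2] ->
    (size c <= 3)%N /\ c`_2 = c2.
  by move=> ->; split; [exact: leq_trans (size_Poly _) _ | rewrite coef_Poly].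
rewrite sqE coef_Poly; case: i => [|[|[|i]]]; rewrite /semaev3_coef /=; last first.
  by rewrite !nth_nil size_poly0 coef0.
- apply: (szP _ (x ^+ 2) (- (2%:R * x))); rewrite /= !cons_poly_def mul0r add0r.
  ring.
- apply: (szP _ (- (2%:R * (x * a + 2%:R * b))) (- (2%:R * (x ^+ 2 + a)))).
  rewrite /= !cons_poly_def mul0r add0r.
  ring.
- apply: (szP _ (a ^+ 2 - 4%:R * b * x) (- (2%:R * x * a + 4%:R * b))).
  rewrite /= !cons_poly_def mul0r add0r.
  ring.
Qed.

Lemma rmorph_mmap (F : nzRingType) (R S : nzRingType) m (f : {rmorphism R -> S})
    (h : F -> R) (v : 'I_m -> R) (p : {mpoly F[m]}) :
  f (mmap h v p) = mmap (f \o h) (f \o v) p.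
Proof.
rewrite /mmap rmorph_sum; apply: eq_bigr => u _; rewrite rmorphM; congr (_ * _).
by rewrite /mmap1 rmorph_prod; apply: eq_bigr => i _; rewrite rmorphXn.
Qed.

Lemma eq_mmap (F : nzRingType) (R : nzRingType) m (h h' : F -> R)
    (v v' : 'I_m -> R) (p : {mpoly F[m]}) :
  h =1 h' -> v =1 v' -> mmap h v p = mmap h' v' p.
Proof.
move=> hE vE; rewrite /mmap; apply: eq_bigr => u _; rewrite hE; congr (_ * _).
exact: mmap1_eq.
Qed.

Lemma mmapX_id (F : comNzRingType) m (p : {mpoly F[m]}) :
  mmap (@mpolyC m F) (fun i => 'X_i) p = p.
Proof.
rewrite [RHS]mpolyE /mmap; apply: eq_bigr => u _.
by rewrite mmap1_id mul_mpolyC.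
Qed.

(** Values come from a sequence indexed by [nat], so that one [x] serves polynomials in different
    numbers of variables. *)
Local Notation mval h x p := (mmap h (fun i : 'I_ _ => x (nat_of_ord i)) p).

(* p(x_0, ..., x_{m-2}, 'X), where m is the number of variables of p *)
Definition last_poly (F S : nzRingType) (h : F -> S) (x : nat -> S) m
    (p : {mpoly F[m]}) : {poly S} :=
  mmap (polyC \o h) (fun i : 'I_m => if (i.+1 < m)%N then (x i)%:P else 'X) p.

Lemma eq_last_poly (F S : nzRingType) (h h' : F -> S) (x x' : nat -> S) m
    (p : {mpoly F[m]}) : h =1 h' -> (forall i, (i.+1 < m)%N -> x i = x' i) ->
  last_poly h x p = last_poly h' x' p.
Proof.
move=> hE xE; apply: eq_mmap => [u|i] /=; first by rewrite hE.
by case: ifP => // /xE ->.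
Qed.

Lemma map_last_poly (F S S' : nzRingType) (f : {rmorphism S -> S'}) (h : F -> S)
    (x : nat -> S) m (p : {mpoly F[m]}) :
  map_poly f (last_poly h x p) = last_poly (f \o h) (f \o x) p.
Proof.
rewrite /last_poly rmorph_mmap; apply: eq_mmap => [u|i] /=.
  by rewrite map_polyC.
by case: ifP; rewrite ?map_polyC ?map_polyX.
Qed.

Lemma last_poly_horner (F : nzRingType) (S : comNzRingType) (h : F -> S)
    (x : nat -> S) m (p : {mpoly F[m]}) z :
  (last_poly h x p).[z] =
  mmap h (fun i : 'I_m => if (i.+1 < m)%N then x i else z) p.
Proof.
rewrite -horner_evalE rmorph_mmap; apply: eq_mmap => [u|i] /=.
  by rewrite horner_evalE hornerC.
by rewrite horner_evalE; case: ifP; rewrite ?hornerC ?hornerX.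
Qed.

Lemma last_poly_mval (F : nzRingType) (S : comNzRingType) (h : F -> S)
    (x : nat -> S) m (p : {mpoly F[m]}) :
  (last_poly h x p).[x m.-1] = mval h x p.
Proof.
rewrite last_poly_horner; apply: eq_mmap => // i.
case: ltnP => // mi; congr x; have := ltn_ord i; lia.
Qed.

(** * The resultant recursion and the degree in the last variable *)

Section Recursion.

Variables (F : fieldType) (a b : F).

Definition genX N (i : nat) : {mpoly F[N.+1]} := 'X_(inord i).

Definition gen_last_poly m (p : {mpoly F[m]}) : {poly {mpoly F[m.+1]}} :=
  last_poly (@mpolyC m.+1 F) (genX m) p.

Lemma mmap_genX (S : comNzRingType) (h : {rmorphism F -> S}) (x : nat -> S) N i :
  (i <= N)%N -> mval h x (genX N i) = x i.
Proof. by move=> iN; rewrite mmapX mmap1U inordK. Qed.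

Lemma mval_mpolyC (S : comNzRingType) (h : {rmorphism F -> S}) (x : nat -> S) N :
  mmap h (fun i : 'I_N => x i) \o (@mpolyC N F) =1 h.
Proof. by move=> u; rewrite /= mmapC. Qed.

Lemma map_gen_last_poly (S : comNzRingType) (h : {rmorphism F -> S})
    (x : nat -> S) m (p : {mpoly F[m]}) :
  map_poly (mmap h (fun i : 'I_m.+1 => x i)) (gen_last_poly p) = last_poly h x p.
Proof.
rewrite /gen_last_poly map_last_poly; apply: eq_last_poly => [|i im].
  exact: mval_mpolyC.
by rewrite /= mmap_genX //; lia.
Qed.

Lemma semaev_stepE m (p : {mpoly F[m]}) :
  semaev_step a b p = resultant (gen_last_poly p)
    (semaev3 (a%:MP)%:P (b%:MP)%:P (genX m m.-1)%:P (genX m m)%:P 'X).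
Proof. by []. Qed.

Lemma genX_inj N i j : (i <= N)%N -> (j <= N)%N -> i != j -> genX N i != genX N j.
Proof.
move=> iN jN; apply: contraNneq => /(congr1 (fun p => p@_U_(inord i))%MM).
rewrite !mcoeffX eqxx; case: eqP => [|_ /eqP]; last by rewrite oner_eq0.
move=> /(congr1 (fun u : 'X_{1..N.+1} => u (inord i))); rewrite !mnm1E eqxx.
by case: eqP => // /(congr1 val); rewrite /= !inordK // => ->.
Qed.

(** The generic degree fixes the shape of the Sylvester matrix before evaluation, and determinants
    commute with ring morphisms. *)
Lemma mval_semaev_step (S : comNzRingType) (h : {rmorphism F -> S})
    (x : nat -> S) m (p : {mpoly F[m]}) d :
  (0 < m)%N -> size (gen_last_poly p) = d.+1 ->
  mval h x (semaev_step a b p) =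
  \det (sylvester d 2 (fun i => (last_poly h x p)`_i)
                      (semaev3_coef (h a) (h b) (x m.-1) (x m))).
Proof.
move=> m0 szp; rewrite semaev_stepE resultant_sylvester szp.
rewrite size_semaev3; last by apply: genX_inj; lia.
rewrite det_sylvester_map; congr (\det _); apply: eq_sylvester => i /=.
  by rewrite -map_gen_last_poly coef_map.
by rewrite coef_semaev3 rmorph_semaev3_coef /= !mmapC !mmap_genX //; lia.
Qed.

Lemma last_poly_semaev_step (S : comNzRingType) (h : {rmorphism F -> S})
    (x : nat -> S) m (p : {mpoly F[m]}) d :
  (0 < m)%N -> size (gen_last_poly p) = d.+1 ->
  let P := last_poly h x (semaev_step a b p) in
  (size P <= (2 * d).+1)%N /\
  P`_(2 * d) = \det (sylvester d 2 (fun i => (last_poly h x p)`_i)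
                       (fun i => (('X - (x m.-1)%:P) ^+ 2)`_i)).
Proof.
(* Keeping the last variable as the indeterminate makes [P] an evaluation over [{poly S}], to which
   [mval_semaev_step] applies. *)
move=> m0 szp P; pose x' i : {poly S} := if (i < m)%N then (x i)%:P else 'X.
have {P} -> : P = \det (sylvester d 2 (fun i => ((last_poly h x p)`_i)%:P)
    (semaev3_coef (h a)%:P (h b)%:P (x m.-1)%:P 'X)).
  have -> : P = mval (polyC \o h) x' (semaev_step a b p) by [].
  rewrite (mval_semaev_step _ _ m0 szp); congr (\det _).
  have xm : x' m.-1 = (x m.-1)%:P by rewrite /x' ltn_predL m0.
  rewrite /= xm {2}/x' ltnn; apply: eq_sylvester => // i.
  suff -> : last_poly (polyC \o h) x' p = map_poly polyC (last_poly h x p) by rewrite coef_map.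
  by rewrite map_last_poly; apply: eq_last_poly => // j jm; rewrite /x' ltnW.
(* The d rows made of coefficients of f_3 are quadratic in the last variable,
   the two other rows are constant. *)
pose D (i : 'I_(2 + d)) := if (i < 2)%N then 0%N else 2%N.
have sumD : (\sum_i D i = 2 * d)%N.
  rewrite big_split_ord /= big1 => [|i _]; last by rewrite /D /= ltn_ord.
  rewrite (eq_bigr (fun=> 2%N)) => [|i _]; last by rewrite /D.
  by rewrite sum_nat_const card_ord mulnC.
rewrite -sumD.
set M := sylvester _ _ _ _.
have szM i j : (size (M i j) <= (D i).+1)%N.
  have szMn (c : {poly S}) k (e : bool) : (size c <= k)%N -> (size (c *+ e) <= k)%N.
    by case: e; rewrite ?mulr0n ?size_poly0.
  rewrite mxE /D; case: ifP => _; apply: szMn; first exact: size_polyC_leq1.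
  by case: (semaev3_coefX (h a) (h b) (x m.-1) (j - (i - 2))).
have [? ->] := coef_det_top szM; split => //.
congr (\det _); apply/matrixP => i j; rewrite !mxE /D; case: ifP => _.
  by rewrite coefMn coefC.
by rewrite coefMn; case: (semaev3_coefX (h a) (h b) (x m.-1) (j - (i - 2))) => _ ->.
Qed.

Lemma last_poly_semaev3 (S : comNzRingType) (h : {rmorphism F -> S}) (x : nat -> S) :
  last_poly h x (summation_poly_rec a b 0) =
  semaev3 (h a)%:P (h b)%:P (x 0)%:P (x 1)%:P 'X.
Proof.
rewrite /last_poly /= rmorph_semaev3 /= !mmapC !mmapX !mmap1U.
by rewrite !inordK.
Qed.

(** If the expected leading coefficient were zero, so would be a resultant with the square of a
    linear factor; this would make the previous polynomial vanish at its own variables. *)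
Lemma size_summation_poly k :
  size (gen_last_poly (summation_poly_rec a b k)) = (2 ^ k.+1).+1.
Proof.
elim: k => [|k IHk].
  by rewrite /gen_last_poly last_poly_semaev3 size_semaev3 //; apply: genX_inj.
set p := summation_poly_rec a b k in IHk *; set d := (2 ^ k.+1)%N in IHk *.
have [szle top] := last_poly_semaev_step (@mpolyC k.+4.+1 F) (genX k.+4) (isT : 0 < k.+3)%N IHk.
apply/eqP; rewrite expnS eqn_leq szle /= ltnNge; apply/negP => szP.
have p0 : p != 0.
  by apply/eqP => p0; move: IHk; rewrite p0 /gen_last_poly /last_poly raddf0 size_poly0.
move: top; rewrite nth_default // => /esym top.
(* [r] removes the last variable, which does not occur in the determinant, to return to the ring of
   [IHk]. *)
pose r : {rmorphism _ -> _} := mmap (@mpolyC k.+4 F) (fun i : 'I_k.+4.+1 => genX k.+3 i).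
have := congr1 r top.
rewrite rmorph0 det_sylvester_map => topr.
have : resultant (gen_last_poly p) (('X - (genX k.+3 k.+2)%:P) ^+ 2) = 0.
  rewrite resultant_sylvester IHk size_exp_XsubC -[RHS]topr.
  congr (\det _); apply: eq_sylvester => i /=.
    suff -> : gen_last_poly p = map_poly r (last_poly (@mpolyC k.+4.+1 F) (genX k.+4) p).
      by rewrite coef_map.
    rewrite map_last_poly; apply: eq_last_poly => [u|j jk] /=; first by rewrite mmapC.
    by rewrite mmap_genX //; lia.
  rewrite -coef_map rmorphXn rmorphB /= map_polyX map_polyC /=.
  by rewrite mmap_genX //; lia.
move/eqP; rewrite resultant_eq0 => nco.
have : ~~ coprimep (gen_last_poly p) (('X - (genX k.+3 k.+2)%:P) ^+ 2).
  by rewrite coprimep_def; case: eqP nco => // ->.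
(* A factor shared with a power of a linear polynomial gives a root, and the value at this root is
   [p] itself. *)
rewrite coprimep_pexpr // coprimep_XsubC negbK /root last_poly_mval => /eqP pX.
case/eqP: p0.
have := congr1 (mmap (@mpolyC k.+3 F) (fun i : 'I_k.+4 => genX k.+2 i)) pX.
rewrite rmorph0 rmorph_mmap => <-; rewrite -[LHS]mmapX_id.
apply: eq_mmap => [u|i]; first by rewrite /= mmapC.
by rewrite /= mmap_genX; [rewrite /genX inord_val | exact: ltnW].
Qed.

End Recursion.

(** * Sums of points and summation polynomials *)

Section EllipticAddition.

Variables (L : fieldType) (A B : L).
Hypothesis two_neq0 : (2%:R : L) != 0.

Lemma ec_add_eq_None P Q : ec_add A (Some P) (Some Q) = None -> P.1 = Q.1.
Proof. by case: P Q => [x1 y1] [x2 y2] /=; case: eqP => //= ->. Qed.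

(** Expressing [A] and [B] through the slope and the coordinates turns both claims into polynomial
    identities, for chord and tangent alike. *)
Lemma ec_add_on_curve_semaev3 P Q R :
  on_curve A B (Some P) -> on_curve A B (Some Q) ->
  ec_add A (Some P) (Some Q) = Some R ->
  on_curve A B (Some R) /\ semaev3 A B P.1 Q.1 R.1 = 0.
Proof.
case: P Q => [x1 y1] [x2 y2] /= /eqP cP /eqP cQ.
case: (altP (x1 =P x2)) => [x12 | x12] /=; last first.
  move=> [<-] /=.
  have d0 : x2 - x1 != 0 by rewrite subr_eq0 eq_sym.
  set s := (y2 - y1) / (x2 - x1).
  have y2E : y2 = y1 + s * (x2 - x1) by rewrite /s mulfVK //; ring.
  (* This is the difference of the two curve equations divided by [x2 - x1]. *)
  have cE : s * (2%:R * y1 + s * (x2 - x1)) = x2 ^+ 2 + x1 * x2 + x1 ^+ 2 + A.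
    apply: (mulfI d0); rewrite y2E in cQ.
    transitivity ((y1 + s * (x2 - x1)) ^+ 2 - y1 ^+ 2); first by ring.
    by rewrite cQ cP; ring.
  clearbody s; have AE : A = s * (2%:R * y1 + s * (x2 - x1)) - (x2 ^+ 2 + x1 * x2 + x1 ^+ 2).
    by rewrite cE; ring.
  have BE : B = y1 ^+ 2 - x1 ^+ 3 - A * x1 by rewrite cP; ring.
  split; first by apply/eqP; rewrite BE AE; ring.
  by rewrite /semaev3 BE AE; ring.
case: ifP => // y12 [<-] /=; subst x2.
(* Equal abscissas without cancellation force [y1 = y2], with [y1] nonzero: the tangent case. *)
have : (y1 - y2) * (y1 + y2) = 0.
  transitivity (y1 ^+ 2 - y2 ^+ 2); first by ring.
  by rewrite cP cQ subrr.
move/eqP; rewrite mulf_eq0 subr_eq0 addr_eq0 y12 orbF => /eqP y2E; subst y2.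
have y0 : 2%:R * y1 != 0.
  rewrite mulf_neq0 //; apply: contraFneq y12 => ->; by rewrite oppr0.
set s := (_ / _).
have sE : s * (2%:R * y1) = 3%:R * x1 ^+ 2 + A by rewrite /s mulfVK.
clearbody s; have AE : A = s * (2%:R * y1) - 3%:R * x1 ^+ 2 by rewrite sE; ring.
have BE : B = y1 ^+ 2 - x1 ^+ 3 - A * x1 by rewrite cP; ring.
split; first by apply/eqP; rewrite BE AE; ring.
by rewrite /semaev3 BE AE; ring.
Qed.

End EllipticAddition.

Definition ec_sum (L : fieldType) (A : L) (s : seq (L * L)) : point L :=
  foldr (@ec_add L A) None [seq Some P | P <- s].

(** The innermost bracket of a right-nested sum is P + (Q + O), so the last two points can be
    merged. *)
Lemma ec_sum_rcons2 (L : fieldType) (A : L) s P Q :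
  ec_sum A (rcons (rcons s P) Q) =
  if ec_add A (Some P) (Some Q) is Some R then ec_sum A (rcons s R) else ec_sum A s.
Proof.
rewrite /ec_sum !map_rcons !foldr_rcons.
have addN (R : L * L) : ec_add A (Some R) None = Some R by case: R.
rewrite addN; case: (ec_add A (Some P) _) => [R|//].
by rewrite map_rcons foldr_rcons addN.
Qed.

Definition abscissa (L : fieldType) (s : seq (L * L)) (i : nat) : L := (nth (0, 0) s i).1.

Lemma abscissa_rcons (L : fieldType) (s : seq (L * L)) P i :
  (i < size s)%N -> abscissa (rcons s P) i = abscissa s i.
Proof. by move=> is_; rewrite /abscissa nth_rcons is_. Qed.

Lemma abscissa_last (L : fieldType) (s : seq (L * L)) P : abscissa (rcons s P) (size s) = P.1.
Proof. by rewrite /abscissa nth_rcons ltnn eqxx. Qed.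

Section CurveSum.

Variables (F : fieldType) (L : fieldType) (h : {rmorphism F -> L}) (a b : F).
Hypothesis two_neq0 : (2%:R : L) != 0.

Local Notation A := (h a).
Local Notation B := (h b).

Lemma size_last_poly_le (x : nat -> L) k :
  (size (last_poly h x (summation_poly_rec a b k)) <= (2 ^ k.+1).+1)%N.
Proof.
by rewrite -(size_summation_poly a b k) -map_gen_last_poly size_poly.
Qed.

(** A joint induction: the vanishing of f_{m+1} uses both claims for f_m, the second one when the
    last two points cancel; the leading coefficient of f_{m+1} uses the vanishing of f_m. *)
Lemma summation_poly_vanishes k :
  (forall s, size s = k.+3 -> all (fun P => on_curve A B (Some P)) s ->
     ec_sum A s = None -> mval h (abscissa s) (summation_poly_rec a b k) = 0)
  /\ (forall s, size s = k.+2 -> all (fun P => on_curve A B (Some P)) s ->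
     ec_sum A s = None ->
     (last_poly h (abscissa s) (summation_poly_rec a b k))`_(2 ^ k.+1) = 0).
Proof.
elim: k => [|k [IHv IHl]].
  split.
    move=> [|P0 [|P1 [|P2 []]]] // _ /= /and4P[c0 c1 c2 _].
    rewrite (ec_sum_rcons2 _ [:: P0]).
    case P12: (ec_add A (Some P1) (Some P2)) => [R|]; last by case: (P0).
    rewrite (ec_sum_rcons2 _ [::]); case P0R: (ec_add _ _ _) => [[]//|] _.
    (* [R] and [P0] cancel and share their abscissa, so the claim is this relation up to the
       symmetry of f_3. *)
    have [_] := ec_add_on_curve_semaev3 two_neq0 c1 c2 P12.
    rewrite -(ec_add_eq_None P0R) -last_poly_mval last_poly_semaev3 horner_semaev3.
    by move=> <-; rewrite /abscissa /semaev3 /=; ring.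
  move=> [|P0 [|P1 []]] // _ _; rewrite (ec_sum_rcons2 _ [::]).
  case P01: (ec_add _ _ _) => [[]//|] _; rewrite last_poly_semaev3 coef_semaev3.
  by rewrite /semaev3_coef /abscissa /= (ec_add_eq_None P01) subrr expr0n.
split.
  move=> s; case/lastP: s => // s' Q; case/lastP: s' => [|t P].
    by rewrite size_rcons.
  rewrite !size_rcons !all_rcons => -[st] /and3P[cQ cP ct].
  rewrite ec_sum_rcons2; set x := abscissa _.
  rewrite (mval_semaev_step a b h x (isT : 0 < k.+3)%N (size_summation_poly a b k)).
  have -> : x k.+3.-1 = P.1.
    by rewrite /x abscissa_rcons ?size_rcons ?st //= -st abscissa_last.
  have -> : x k.+3 = Q.1.
    by rewrite /x -[k.+3](_ : size (rcons t P) = _) ?abscissa_last ?size_rcons ?st.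
  have xt i : (i.+1 < k.+3)%N -> x i = abscissa t i.
    by move=> ik; rewrite /x !abscissa_rcons ?size_rcons //; lia.
  have q_sz := size_semaev3_le A B P.1 Q.1.
  have p_sz := size_last_poly_le x k.
  have d0 : (0 < 2 ^ k.+1)%N by rewrite expn_gt0.
  rewrite -(eq_sylvester _ _ (frefl _) (coef_semaev3 A B P.1 Q.1)).
  case PQ: (ec_add A (Some P) (Some Q)) => [R|] sum0.
    have [cR q0] := ec_add_on_curve_semaev3 two_neq0 cP cQ PQ.
    apply: (@sylvester_common_root _ _ _ _ _ R.1) => //; last by rewrite horner_semaev3.
    (* At [R.1] the first polynomial takes the value of f_m on the shortened list [rcons t R], whose
       sum is still O. *)
    rewrite -(IHv (rcons t R)) ?size_rcons ?st ?all_rcons ?cR //.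
    rewrite last_poly_horner; apply: eq_mmap => // i.
    case: ifP => [/[dup] ik /xt ->|ik]; first by rewrite abscissa_rcons //; lia.
    have -> : nat_of_ord i = size t by have := ltn_ord i; lia.
    by rewrite abscissa_last.
  apply: sylvester_lead0 => //.
    rewrite (eq_last_poly (h' := h) (x' := abscissa t)) //; exact: IHl.
  by rewrite coef_semaev3 /semaev3_coef /= (ec_add_eq_None PQ) subrr expr0n.
move=> s szs cs sum0.
have [_] := last_poly_semaev_step a b h (abscissa s) (isT : 0 < k.+3)%N (size_summation_poly a b k).
rewrite -expnS => ->.
apply: (@sylvester_common_root _ _ _ _ _ (abscissa s k.+2)).
- by rewrite expn_gt0.
- exact: size_last_poly_le.
- by rewrite size_exp_XsubC.
- by rewrite (last_poly_mval h (abscissa s) (summation_poly_rec a b k)) IHv.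
- by rewrite horner_exp hornerXsubC subrr expr0n.
Qed.

End CurveSum.

(** * Frobenius action on the trace zero subgroup *)

Definition map_aff (K K' : fieldType) (f : K -> K') (P : K * K) : K' * K' :=
  (f P.1, f P.2).

(** Field morphisms are injective, so they preserve the case distinctions, and the formulas are
    rational in the coordinates and [a]. *)
Lemma ec_add_map (K K' : fieldType) (f : {rmorphism K -> K'}) (a : K) (P Q : point K) :
  omap (map_aff f) (ec_add a P Q) =
  ec_add (f a) (omap (map_aff f) P) (omap (map_aff f) Q).
Proof.
case: P Q => [[x1 y1]|] [[x2 y2]|] //=.
rewrite -rmorphN !(inj_eq (fmorph_inj f)).
case: ifP => // _; congr Some; rewrite /map_aff /=.
set s := if _ then _ else _; set s' := if _ then _ else _.
have <- : f s = s'.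
  by rewrite /s /s'; case: ifP => _; rewrite fmorph_div;
     congr (_ / _); ring.
by congr (_, _); ring.
Qed.

Lemma ec_add_opp (K : fieldType) (a : K) (P Q : point K) :
  omap (@aff_opp K) (ec_add a P Q) =
  ec_add a (omap (@aff_opp K) P) (omap (@aff_opp K) Q).
Proof.
case: P Q => [[x1 y1]|] [[x2 y2]|] //=.
rewrite eqr_opp opprK -eqr_oppLR.
case: ifP => // _; congr Some; rewrite /aff_opp /=.
set s := if _ then _ else _; set s' := if _ then _ else _.
have -> : s' = - s.
  rewrite /s /s'; case: ifP => _; last by rewrite -mulNr; congr (_ / _); ring.
  by rewrite mulrN invrN mulrN.
by congr (_, _); ring.
Qed.

Lemma big_ec_add_map (K K' : fieldType) (f : K * K -> K' * K') (a : K) (a' : K') n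
    (P : 'I_n -> point K) :
  (forall P Q, omap f (ec_add a P Q) = ec_add a' (omap f P) (omap f Q)) ->
  omap f (\big[@ec_add K a/None]_(i < n) P i) =
  \big[@ec_add K' a'/None]_(i < n) omap f (P i).
Proof. by move=> fD; apply: big_morph. Qed.

Lemma on_curve_map (K K' : fieldType) (f : {rmorphism K -> K'}) (a b : K) P :
  on_curve a b (Some P) -> on_curve (f a) (f b) (Some (map_aff f P)).
Proof.
by case: P => x y /= /eqP cP; rewrite -rmorphXn cP; apply/eqP; ring.
Qed.

Lemma on_curve_opp (K : fieldType) (a b : K) P :
  on_curve a b (Some P) -> on_curve a b (Some (aff_opp P)).
Proof. by case: P => x y; rewrite /= sqrrN. Qed.

Lemma mmap_mesym (F : nzRingType) (R : comNzRingType) n (h : {rmorphism F -> R}) (v : 'I_n -> R) k :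
  mmap h v (mesym n F k) = \sum_(J : {set 'I_n} | #|J| == k) \prod_(j in J) v j.
Proof.
rewrite /mesym raddf_sum /=; apply: eq_bigr => J _.
by rewrite rmorph_prod; apply: eq_bigr => j _; rewrite /= mmapX mmap1U.
Qed.

Lemma iter_aff_frob (K : fieldType) q i (P : K * K) :
  iter i (aff_frob q) P = (P.1 ^+ (q ^ i), P.2 ^+ (q ^ i)).
Proof.
elim: i => [|i IHi]; first by rewrite expn0 !expr1; case: P.
by rewrite iterS IHi /aff_frob /= -!exprM -!expnSr.
Qed.

Section Frobenius.

Variables (F L : finFieldType) (h : {rmorphism F -> L}).
Local Notation q := #|F|.

(** As q is a power of the characteristic p, the map is an iterate of the p-power Frobenius. *)
Lemma frobenius_rmorphism : exists f : {rmorphism L -> L}, forall x, f x = x ^+ q.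
Proof.
have [p _ pF] := finPcharP F.
have /p_natP[k ->] : p.-nat q.
  by have := abelem_pgroup (fin_ring_pchar_abelem pF); rewrite /pgroup cardsT.
have pL := rmorph_pchar h pF.
elim: k => [|k [f fE]]; first by exists idfun.
exists (pFrobenius_aut pL \o f) => x.
by rewrite /= pFrobenius_autE fE -exprM -expnSr.
Qed.

Lemma expr_card_fixed (c : F) : h c ^+ q = h c.
Proof. by rewrite -rmorphXn expf_card. Qed.

Variables (A B : F) (n : nat).
Hypothesis cardL : #|L| = (q ^ n)%N.

Local Notation T := (aff_trace_zero (h A) (h B) q n).

Lemma mem_aff_trace_zero P :
  (P \in T) = on_curve (h A) (h B) (Some P) && (ec_trace (h A) q n (Some P) == None).
Proof. by rewrite !inE. Qed.

Lemma frob_some i (P : L * L) :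
  iter i (frob q) (Some P) = Some (iter i (aff_frob q) P).
Proof. by elim: i => //= i ->. Qed.

Lemma aff_frob_trace_zero P : P \in T -> aff_frob q P \in T.
Proof.
have [f fE] := frobenius_rmorphism.
have mapE (Q : L * L) : aff_frob q Q = map_aff f Q by rewrite /map_aff !fE.
have fA c : f (h c) = h c by rewrite fE expr_card_fixed.
rewrite !mem_aff_trace_zero mapE => /andP[cP /eqP tP]; apply/andP; split.
  by have := on_curve_map f cP; rewrite !fA.
have fD P' Q : omap (map_aff f) (ec_add (h A) P' Q) =
    ec_add (h A) (omap (map_aff f) P') (omap (map_aff f) Q).
  by rewrite ec_add_map fA.
have := big_ec_add_map (fun i : 'I_n => iter i (frob q) (Some P)) fD.
rewrite [X in omap _ X]tP /= => /esym/eqP; congr (_ == _).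
(* Frobenius commutes with its iterates, so its value on the trace of [P] is termwise the trace of
   its value on [P]. *)
apply: eq_bigr => i _; rewrite !frob_some /=; congr Some.
by rewrite -!mapE -iterS -iterSr.
Qed.

Lemma aff_opp_frob i (P : L * L) :
  iter i (aff_frob q) (aff_opp P) = aff_opp (iter i (aff_frob q) P).
Proof.
have [f fE] := frobenius_rmorphism.
by elim: i => //= i ->; rewrite /aff_frob /aff_opp /= -!fE rmorphN.
Qed.

Lemma aff_opp_trace_zero P : P \in T -> aff_opp P \in T.
Proof.
rewrite !mem_aff_trace_zero => /andP[cP /eqP tP]; apply/andP; split.
  exact: on_curve_opp.
have := big_ec_add_map (fun i : 'I_n => iter i (frob q) (Some P)) (ec_add_opp (h A)).
rewrite [X in omap _ X]tP /= => /esym/eqP; congr (_ == _).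
by apply: eq_bigr => i _; rewrite !frob_some /= aff_opp_frob.
Qed.

(** The right side lies in F_q, hence is fixed by Frobenius, which can then be moved onto each
    conjugate. *)
Lemma esym_conj_expr i (x : L) : esym_conj q n i (x ^+ q) = esym_conj q n i x.
Proof.
have [f fE] := frobenius_rmorphism.
rewrite -[RHS](esym_conj_frob h i x cardL) -[RHS]fE /esym_conj /meval.
rewrite rmorph_mmap !mmap_mesym /=.
apply: eq_bigr => J _; apply: eq_bigr => j _.
by rewrite fE -!exprM mulnC.
Qed.

Lemma iter_aff_frob_card (P : L * L) : iter n (aff_frob q) P = P.
Proof. by rewrite iter_aff_frob -cardL !expf_card; case: P. Qed.

Lemma iter_aff_frob_mod i (P : L * L) :
  iter i (aff_frob q) P = iter (i %% n) (aff_frob q) P.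
Proof.
rewrite {1}(divn_eq i n) addnC iterD iterM; congr (iter _ _ _).
exact/iter_fix/iter_aff_frob_card.
Qed.

Hypothesis n_gt0 : (0 < n)%N.

(** The exponent may be any natural number because the n-th iterate of Frobenius is the identity;
    composing maps then requires no reduction modulo [n]. *)
Lemma eq_classP (P Q : L * L) :
  reflect (exists i (e : bool), Q = iter e (@aff_opp L) (iter i (aff_frob q) P))
          (Q \in eq_class q n P).
Proof.
apply: (iffP setUP) => [[/imsetP[i _ ->]|/imsetP[i _ ->]]|[i [e ->]]].
- by exists i, false.
- by exists i, true.
have im : (i %% n < n)%N by rewrite ltn_mod.
rewrite iter_aff_frob_mod; case: e; [right|left];
by apply/imsetP; exists (Ordinal im).
Qed.

Lemma aff_oppK : involutive (@aff_opp L).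
Proof. by case=> x y; rewrite /aff_opp /= opprK. Qed.

Lemma aff_opp_addb (e e' : bool) (P : L * L) :
  iter e (@aff_opp L) (iter e' (@aff_opp L) P) = iter (e (+) e') (@aff_opp L) P.
Proof. by case: e e' => [] [] //=; rewrite aff_oppK. Qed.

Lemma aff_frob_iter_opp i (e : bool) (P : L * L) :
  iter i (aff_frob q) (iter e (@aff_opp L) P) =
  iter e (@aff_opp L) (iter i (aff_frob q) P).
Proof. by case: e => //=; rewrite aff_opp_frob. Qed.

Lemma eq_class_sub (P Q : L * L) :
  Q \in eq_class q n P -> eq_class q n Q \subset eq_class q n P.
Proof.
move=> /eq_classP[i [e ->]]; apply/subsetP => R /eq_classP[j [e' ->]].
apply/eq_classP; exists (j + i)%N, (e' (+) e).
by rewrite aff_frob_iter_opp aff_opp_addb iterD.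
Qed.

Lemma eq_class_refl (P : L * L) : P \in eq_class q n P.
Proof. by apply/eq_classP; exists 0, false. Qed.

Lemma eq_class_sym (P Q : L * L) : Q \in eq_class q n P -> P \in eq_class q n Q.
Proof.
move=> /eq_classP[i [e ->]]; apply/eq_classP; exists (n - i %% n)%N, e.
rewrite aff_frob_iter_opp aff_opp_addb addbb /= iter_aff_frob_mod.
rewrite [iter i _ _]iter_aff_frob_mod -iter_aff_frob_mod -iterD subnK.
  by rewrite iter_aff_frob_card.
by rewrite ltnW // ltn_mod.
Qed.

Lemma eq_class_eq (P Q : L * L) : Q \in eq_class q n P -> eq_class q n Q = eq_class q n P.
Proof.
move=> PQ; apply/eqP; rewrite eqEsubset !eq_class_sub //; exact: eq_class_sym.
Qed.

(** The e_i are up to sign the coefficients of the product of the factors ['X - c%:P] over the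
    conjugates [c], so [Q.1] is a conjugate of [P.1]; the curve equation then fixes the ordinate up
    to sign. *)
Lemma eq_class_of_esym (P Q : L * L) :
  on_curve (h A) (h B) (Some P) -> on_curve (h A) (h B) (Some Q) ->
  (forall i, (i < n)%N -> esym_conj q n i.+1 P.1 = esym_conj q n i.+1 Q.1) ->
  Q \in eq_class q n P.
Proof.
move=> cP cQ esymPQ.
pose cs (x : L) := [tuple x ^+ (q ^ j) | j < n].
have csE x k : (mesym n L k).@[tnth (cs x)] = esym_conj q n k x.
  by apply: eq_mmap => // j; rewrite tnth_mktuple.
have : \prod_(c <- cs P.1) ('X - c%:P) = \prod_(c <- cs Q.1) ('X - c%:P).
  (* The coefficient of degree [k] is e_{n-k} up to sign; for [k = n] this is e_0 = 1 on both
     sides. *)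
  apply/polyP => k; have [kn|kn] := leqP k n; last first.
    by rewrite !nth_default // size_prod_XsubC size_tuple.
  have nk : (n - k < n.+1)%N by lia.
  have := mroots_coeff (cs P.1) (Ordinal nk); have := mroots_coeff (cs Q.1) (Ordinal nk).
  rewrite /= subKn // !csE => -> ->; congr (_ * _).
  by case: (n - k)%N nk => [|i] ni; [rewrite /esym_conj mesym0E !meval1 | exact: esymPQ].
move=> /(congr1 (root ^~ Q.1)); rewrite !root_prod_XsubC.
have -> : Q.1 \in cs Q.1.
  apply/tnthP; exists (Ordinal n_gt0); by rewrite tnth_mktuple expn0 expr1.
move=> /tnthP[j]; rewrite tnth_mktuple => xQ.
have [f fE] : exists f : {rmorphism L -> L}, forall x, f x = x ^+ (q ^ j).
  have [f fE] := frobenius_rmorphism.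
  elim: (nat_of_ord j) => [|i [fi fiE]]; first by exists idfun.
  by exists (f \o fi) => x; rewrite /= fE fiE -exprM -expnSr.
have fA c : f (h c) = h c.
  by rewrite fE; elim: (nat_of_ord j) => // i IHi; rewrite expnSr exprM IHi expr_card_fixed.
(* The [j]-th Frobenius image of [P] lies on the same curve and has the abscissa of [Q], so the two
   ordinates have equal squares. *)
have := on_curve_map f cP; rewrite !fA /=; move: cQ; case: Q xQ {esymPQ} => x y /= ->.
rewrite !fE => /eqP cQ /eqP cjP.
have : (y == P.2 ^+ (q ^ j)) || (y == - P.2 ^+ (q ^ j)).
  by rewrite -eqf_sqr cQ cjP.
move=> yE; apply/eq_classP; exists j.
case/orP: yE => /eqP ->; [exists false|exists true]; by rewrite iter_aff_frob.
Qed.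

End Frobenius.

(** * Counting classes by the norm of the abscissa *)

Lemma summation_poly_trace_zero (F L : finFieldType) (h : {rmorphism F -> L}) (A B : F) n
    (P : L * L) :
  2%N \notin [pchar F] -> (2 < n)%N ->
  P \in aff_trace_zero (h A) (h B) #|F| n ->
  mmap h (fun i : 'I_n => P.1 ^+ (#|F| ^ i)) (summation_poly A B n) = 0.
Proof.
move=> char2; case: n => [|[|[|k]]] // _; rewrite mem_aff_trace_zero => /andP[cP /eqP tP].
have two_neq0 : 2%:R != 0 :> L.
  rewrite -(rmorph_nat h) fmorph_eq0; apply: contra char2 => F2.
  by rewrite inE F2.
pose s := mkseq (fun i => iter i (aff_frob #|F|) P) k.+3.
have sum_s : ec_sum (h A) s = None.
  (* The iterated operation unfolds to a right fold, so the trace is exactly [ec_sum] of the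
     conjugates in order. *)
  rewrite -tP /ec_trace -(big_mkord xpredT (fun i => iter i (frob #|F|) (Some P))).
  rewrite /ec_sum foldrE !big_map /index_iota subn0.
  by apply: eq_bigr => i _; rewrite frob_some.
have [/(_ s) + _] := summation_poly_vanishes h A B two_neq0 k.
rewrite size_mkseq => /(_ erefl) vanish; rewrite -[RHS]vanish //; last first.
  apply/allP => Q /mapP[i _ ->]; elim: i => [//|i /(on_curve_map _) IHi].
  have [f fE] := frobenius_rmorphism h.
  have := IHi _ f; rewrite !fE !expr_card_fixed.
  by rewrite iterS /map_aff !fE.
apply: eq_mmap => // i.
by rewrite /abscissa nth_mkseq // iter_aff_frob.
Qed.

Lemma specialize_last_horner (F : fieldType) n (g : {mpoly F[n]}) (S : n.-1.-tuple F) z :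
  (specialize_last g S).[z] =
  mmap (@idfun F) (fun i : 'I_n => if (i < n.-1)%N then S`_i else z) g.
Proof.
rewrite -horner_evalE rmorph_mmap; apply: eq_mmap => [u|i] /=.
  by rewrite horner_evalE hornerC.
by rewrite horner_evalE; case: ifP; rewrite ?hornerC ?hornerX.
Qed.

Lemma size_specialize_last (F : fieldType) n (g : {mpoly F[n]}) (S : n.-1.-tuple F) :
  (size (specialize_last g S) <= (last_degree g).+1)%N.
Proof.
apply: leq_trans (size_sum _ _ _) _.
apply/bigmax_leqP_seq => m mg _; rewrite mul_polyC.
apply: leq_trans (size_scale_leq _ _) _.
(* In each monomial only the last variable contributes to the degree in ['X]. *)
pose D (i : 'I_n) := if (i < n.-1)%N then 0%N else m i.
have szD (i : 'I_n) :
    (size (((if (i < n.-1)%N then (S`_i)%:P else 'X) : {poly F}) ^+ m i)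
      <= (D i).+1)%N.
  rewrite /D; case: ifP => _; last by rewrite size_polyXn.
  by rewrite -polyC_exp size_polyC_leq1.
have [sz _] := coef_prod_top (index_enum 'I_n) szD.
apply: leq_trans sz _; rewrite ltnS.
rewrite /last_degree; apply: leq_trans (leq_bigmax_seq _ mg isT).
case: n => [|n] in g S m mg D szD *; first by rewrite big_ord0.
rewrite big_ord_recr /= big1 => [|i _]; last by rewrite /D /= ltn_ord.
by rewrite add0n /D /= ltnn (mnm_nth 0%N).
Qed.

Lemma root_specialize_last (F L : finFieldType) (h : {rmorphism F -> L}) (A B : F) n
    (g : {mpoly F[n]}) (Q : L * L) :
  2%N \notin [pchar F] -> (2 < n)%N -> #|L| = (#|F| ^ n)%N ->
  is_symmetrization (summation_poly A B n) g ->
  Q \in aff_trace_zero (h A) (h B) #|F| n ->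
  root (specialize_last g (compr h n Q)) (descend h (esym_conj #|F| n n Q.1)).
Proof.
move=> char2 n2 cardL sym_g QT.
rewrite /root -(fmorph_eq0 h) specialize_last_horner rmorph_mmap.
rewrite -(summation_poly_trace_zero char2 n2 QT) sym_g /comp_mpoly rmorph_mmap.
apply/eqP; apply: eq_mmap => [u|i] /=; first by rewrite mmapC.
rewrite tnth_mktuple mmap_mesym.
have -> : \sum_(J : {set 'I_n} | #|J| == i.+1) \prod_(j in J) Q.1 ^+ (#|F| ^ j) =
    esym_conj #|F| n i.+1 Q.1 by rewrite /esym_conj /meval mmap_mesym.
case: ifP => ilt; last first.
  (* Here [i] is the last index, so e_{i+1} is the norm e_n. *)
  rewrite descendK ?(esym_conj_frob h) //; congr esym_conj.
  by have := ltn_ord i; lia.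
by rewrite -(comprE h Q (Ordinal ilt) cardL) (tnth_nth 0).
Qed.

(** On [D] the map [f] factors through [g]: [r] chooses a preimage in [D], and its default is never
    reached on the image of [D]. *)
Lemma leq_card_imset_factor (T U V : finType) (f : T -> U) (g : T -> V) (D : {set T}) :
  {in D &, forall x y, g x = g y -> f x = f y} -> (#|f @: D| <= #|g @: D|)%N.
Proof.
move=> fg; have [->|/set0Pn[x0 x0D]] := eqVneq D set0; first by rewrite imset0 cards0.
pose r v := odflt x0 [pick x in D | g x == v].
apply: leq_trans (leq_imset_card (f \o r) _); apply/subset_leq_card/subsetP.
move=> _ /imsetP[x xD ->]; apply/imsetP; exists (g x); first exact: imset_f.
rewrite /= /r; case: pickP => [y /andP[yD /eqP gy]|/(_ x)]; last by rewrite xD eqxx.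
exact: fg.
Qed.

Theorem mainTheorem3 (F L : finFieldType) (iota : {rmorphism F -> L})
    (A B : F) (n : nat) (g : {mpoly F[n]}) (P : L * L) :
  2%N \notin [pchar F] -> 3%N \notin [pchar F] ->
  elliptic A B ->
  prime n -> odd n ->
  #|L| = (#|F| ^ n)%N ->
  is_symmetrization (summation_poly A B n) g ->
  let T := aff_trace_zero (iota A) (iota B) #|F| n in
  P \in T ->
  specialize_last g (compr iota n P) != 0 ->
  exists C : {set {set L * L}},
    [/\ C \subset [set eq_class #|F| n Q | Q in T],
        (#|C| <= last_degree g)%N
      & [set Q in T | compr iota n Q == compr iota n P]
          = \bigcup_(c in C) c].
Proof.
move=> char2 _ _ n_prime n_odd cardL sym_g T PT spec_neq0.
have n2 : (2 < n)%N by exact: odd_prime_gt2.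
have n0 : (0 < n)%N by exact: prime_gt0.
set D := [set Q in T | _].
pose N (Q : L * L) := descend iota (esym_conj #|F| n n Q.1).
exists (eq_class #|F| n @: D); split.
- by apply/imsetS/subsetP => Q; rewrite inE => /andP[].
(* Within [D] the first n - 1 symmetric functions agree, so the norm alone determines the class. *)
- have clsN : {in D &, forall Q R, N Q = N R -> eq_class #|F| n Q = eq_class #|F| n R}.
    move=> Q R /setIdP[QT /eqP cQ] /setIdP[RT /eqP cR] NQR.
    apply/esym/(eq_class_eq iota cardL n0).
    apply: (eq_class_of_esym (h := iota) (A := A) (B := B)) => //.
    + by move: QT; rewrite mem_aff_trace_zero => /andP[].
    + by move: RT; rewrite mem_aff_trace_zero => /andP[].
    move=> i ltin; have [i1|i1] := ltnP i n.-1.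
      by rewrite -!(comprE iota _ (Ordinal i1) cardL) cQ cR.
    have -> : i.+1 = n by lia.
    have := congr1 iota NQR.
    by rewrite /N !descendK ?(esym_conj_frob iota).
  apply: leq_trans (leq_card_imset_factor clsN) _.
  (* The norms are distinct roots of a nonzero polynomial, hence fewer than its size. *)
  rewrite -ltnS; apply: leq_trans (size_specialize_last g (compr iota n P)).
  rewrite cardE; apply: max_poly_roots => //; last exact: enum_uniq.
  apply/allP => z; rewrite mem_enum => /imsetP[Q /setIdP[QT /eqP <-] ->].
  exact: root_specialize_last sym_g QT.
(* The fibre [D] is closed under sign and Frobenius, so the classes of its points do not leave
   it. *)
have stable Q R : Q \in D -> R \in eq_class #|F| n Q -> R \in D.
  move=> + /(eq_classP cardL n0)[i [e ->]].
  move=> /setIdP[QT /eqP cQ]; apply/setIdP; split.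
    have oppT : iter i (aff_frob #|F|) Q \in T.
      by elim: i => //= i; exact: aff_frob_trace_zero.
    by case: e => //=; exact: aff_opp_trace_zero.
  rewrite -cQ; apply/eqP/eq_from_tnth => j; rewrite !tnth_mktuple; congr descend.
  have -> : (iter e (@aff_opp L) (iter i (aff_frob #|F|) Q)).1 =
      (iter i (aff_frob #|F|) Q).1 by case: e.
  by elim: i => //= i IHi; rewrite (esym_conj_expr iota).
apply/setP => R; apply/idP/bigcupP => [RD|[_ /imsetP[Q QD ->]]]; last exact: stable.
by exists (eq_class #|F| n R); [exact: imset_f | exact: (eq_class_refl cardL n0)].
Qed.
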